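(* Let $\Lambda$ be a Borel probability measure on $\mathbb{R}$ and let $(\mu_n)_{n=1}^\infty$ be a sequence of Borel probability measures on $\mathbb{R}$ that converges to $\Lambda$ in distribution, i.e., $$\lim_{n\to\infty}\int_{\mathbb{R}}\varphi\,d\mu_n=\int_{\mathbb{R}}\varphi\,d\Lambda$$ for every bounded continuous function $\varphi\colon\mathbb{R}\to\mathbb{C}$. Suppose moreover that $\operatorname{supp}(\Lambda)$ is a bounded and connected set and that $\operatorname{supp}(\mu_n)\subseteq\operatorname{supp}(\Lambda)$ for every $n\in\mathbb{N}$. Then the quantile functions $Q_{\mu_n}$ converge uniformly on $[0,1]$ to $Q_\Lambda$: $$\lim_{n\to\infty}\sup_{p\in[0,1]}|Q_{\mu_n}(p)-Q_\Lambda(p)|=0.$$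
   Context: For a Borel probability measure $\mu$ on $\mathbb{R}$, the cumulative distribution function $F_\mu\colon\mathbb{R}\to[0,1]$ and the quantile function $Q_\mu\colon(0,1)\to\mathbb{R}$ are $$F_\mu(v):=\mu(-\infty,v],\qquad Q_\mu(p):=\inf\{v\in\mathbb{R}\colon F_\mu(v)\ge p\}.$$ The support of $\mu$ is $\operatorname{supp}(\mu):=\{v\in\mathbb{R}\colon \mu(v-\varepsilon,v+\varepsilon)>0\ \ \forall\varepsilon>0\}$. If $\mu$ has bounded support, then $Q_\mu$ has finite limits at $0$ and $1$, and $Q_\mu$ is extended to $[0,1]$ by $Q_\mu(0):=\lim_{p\to0^+}Q_\mu(p)$ and $Q_\mu(1):=\lim_{p\to1^-}Q_\mu(p)$. *)

(* Defs.v *)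
From mathcomp Require Import all_boot all_order all_algebra.
From mathcomp Require Import all_classical all_reals all_analysis.
From mathcomp Require Import complex.
Set Implicit Arguments.
Unset Strict Implicit.
Unset Printing Implicit Defensive.
Import Order.TTheory GRing.Theory Num.Theory.
Import numFieldNormedType.Exports.
Local Open Scope classical_set_scope.
Local Open Scope ring_scope.
Local Open Scope complex_scope.

Definition cumul (R : realType) (mu : probability (measurableTypeR R) R) (v : R) : R :=
  fine (mu `]-oo, v]%classic).

Definition quantile_in (R : realType) (mu : probability (measurableTypeR R) R) (p : R) : R :=
  inf [set v : R | p <= cumul mu v].

(* [quantile_in] is meaningful only on ]0, 1[.  [quantile] extends it to
   [0, 1]; the two limits exist when the support of [mu] is bounded. *)
Definition quantile (R : realType) (mu : probability (measurableTypeR R) R) (p : R) : R :=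
  if p == 0 then lim (quantile_in mu q @[q --> 0^'+])
  else if p == 1 then lim (quantile_in mu q @[q --> 1^'-])
  else quantile_in mu p.

Definition supp (R : realType) (mu : probability (measurableTypeR R) R) : set R :=
  [set v | forall e : R, 0 < e -> (0 < mu `](v - e)%R, (v + e)%R[%classic)%E].

Definition cintegral (R : realType) (mu : probability (measurableTypeR R) R) (f : R -> R[i]) :
    R[i]^o :=
  (\int[mu]_x complex.Re (f x)) +i* (\int[mu]_x complex.Im (f x)).

(* [R[i]^o] is the field [R[i]] of complex numbers with the topology and norm
   given by its modulus. *)
Definition cvg_in_distribution (R : realType)
    (mu : nat -> probability (measurableTypeR R) R) (Lam : probability (measurableTypeR R) R) :=
  forall f : R -> R[i]^o, continuous f -> bounded_fun f ->
    cintegral (mu n) f @[n --> \oo] --> cintegral Lam f.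

(* Main.v *)
Require Import Defs.
From HB Require Import structures.
From mathcomp Require Import all_boot all_order all_algebra.
From mathcomp Require Import all_classical all_reals all_analysis.
From mathcomp Require Import complex lra.
Import Order.TTheory GRing.Theory Num.Theory.
Import numFieldNormedType.Exports.
Local Open Scope classical_set_scope.
Local Open Scope ring_scope.
Set Implicit Arguments.
Unset Strict Implicit.
Unset Printing Implicit Defensive.

(** For [0 < p < 1] every quantile [Q_mu p] lies in [supp mu], so all the
    quantiles involved lie in the interval [supp Lam].  If [s < v < u] with [v]
    in [supp Lam], then [Lam] charges a neighbourhood of [v] and testing against
    piecewise linear ramps gives [F_Lam s <= F_(mu n) u] and
    [F_(mu n) s <= F_Lam u] for [n] large.  Apply this to the finitely many
    consecutive pairs of a grid of mesh [e / 2] covering [supp Lam]: whenever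
    [x + e < y] with [x], [y] in [supp Lam], some grid cell meeting [supp Lam]
    lies between [x] and [y], so two quantiles of the same order cannot be more
    than [e] apart.  The endpoints [p = 0, 1] follow by passing to the limit. *)

(** * Distribution function and quantiles of a single measure *)

Section cumulative.
Context {R : realType} (mu : probability (measurableTypeR R) R).

(** Viewing [mu] as the law of the identity random variable makes the general facts on [cdf]
    available for [cumul mu]. *)
Let idTR : measurableTypeR R -> R := idfun.

#[local] HB.instance Definition _ :=
  @isMeasurableFun.Build _ _ _ _ idTR (@measurable_id _ _ setT).

Lemma cumulE v : (cumul mu v)%:E = mu `]-oo, v]%classic.
Proof. by rewrite /cumul fineK// fin_num_measure. Qed.

Lemma cumul_nondecreasing : {homo cumul mu : s t / s <= t}.
Proof.
move=> s t st; rewrite fine_le ?fin_num_measure//.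
by rewrite (cdf_nondecreasing (idTR : {RV mu >-> R})).
Qed.

Lemma cumul_right_continuous : right_continuous (cumul mu).
Proof.
move=> a; apply: fine_cvg; rewrite cumulE.
exact: (@cdf_right_continuous _ _ _ _ (idTR : {RV mu >-> R}) a).
Qed.

Lemma cvg_cumulNy : cumul mu @ -oo --> (0 : R).
Proof. exact/fine_cvg/(cvg_cdfNy0 (idTR : {RV mu >-> R})). Qed.

Lemma cvg_cumuly : cumul mu @ +oo --> (1 : R).
Proof. exact/fine_cvg/(cvg_cdfy1 (idTR : {RV mu >-> R})). Qed.

Lemma cumul_le_add s u w : u < w ->
  (mu `]-oo, u]%classic <= mu `]-oo, s]%classic + mu `]s, w[%classic)%E.
Proof.
move=> uw; apply: (@le_trans _ _ (mu (`]-oo, s] `|` `]s, w[)%classic)); last first.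
  exact: measureU2.
apply: le_measure; rewrite ?inE//; first exact: measurableU.
move=> x /=; rewrite !in_itv/= => xu.
by case: (leP x s) => xs; [left|right => /=; exact: le_lt_trans uw].
Qed.

Lemma cumul_add_le s u : s <= u ->
  (mu `]-oo, s]%classic + mu `]s, u[%classic <= mu `]-oo, u]%classic)%E.
Proof.
move=> su; rewrite -measureU//; last first.
  rewrite -subset0 => x [] /=; rewrite !in_itv/= => xs /andP[sx _].
  by move: (le_lt_trans xs sx); rewrite ltxx.
apply: le_measure; rewrite ?inE//; first exact: measurableU.
move=> x [] /=; rewrite !in_itv/=; first by move/le_trans; apply.
by move=> /andP[_ /ltW].
Qed.

(** Right continuity of [cumul mu] makes the infimum attained, whence this Galois connection,
    through which all later facts on quantiles pass. *)
Lemma quantile_in_le p v : 0 < p < 1 ->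
  (quantile_in mu p <= v) = (p <= cumul mu v).
Proof.
move=> /andP[p0 p1].
(* [inf] is the true infimum only for a nonempty set that is bounded below. The limits of [cumul mu]
   at the two infinities give both, by [0 < p] and [p < 1]. *)
have lbA : has_lbound [set v : R | p <= cumul mu v].
  have [w Fw] : exists w, cumul mu w < p.
    exact: filter_ex (cvgr_lt (0 : R) cvg_cumulNy _ p0).
  exists w => x /= px; rewrite leNgt; apply/negP => /ltW /cumul_nondecreasing xw.
  by move: (le_lt_trans (le_trans px xw) Fw); rewrite ltxx.
have A0 : [set v : R | p <= cumul mu v] !=set0.
  have [w Fw] : exists w, p < cumul mu w.
    exact: filter_ex (cvgr_gt (1 : R) cvg_cumuly _ p1).
  by exists w; exact: ltW.
apply/idP/idP => [Qv|pv]; last exact: ge_inf.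
apply: le_trans (cumul_nondecreasing Qv); rewrite leNgt; apply/negP => Fp.
(* A value below [p] at the infimum would persist at some [x] to its right, yet the set has an
   element below [x]. *)
have Fp_near : \forall x \near (quantile_in mu p)^'+, cumul mu x < p.
  exact: cvgr_lt (@cumul_right_continuous (quantile_in mu p)) _ Fp.
have [x [Fx Qx]] : exists x, cumul mu x < p /\ quantile_in mu p < x.
  near (quantile_in mu p)^'+ => x; exists x; split; near: x => //.
  exact: nbhs_right_gt.
have [a pa ax] := inf_lt A0 Qx.
have := le_trans pa (cumul_nondecreasing (ltW ax)).
by rewrite leNgt Fx.
Unshelve. all: by end_near. Qed.

Lemma quantile_in_nondecreasing p q :
  0 < p < 1 -> 0 < q < 1 -> p <= q -> quantile_in mu p <= quantile_in mu q.
Proof.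
move=> p01 q01 pq; rewrite quantile_in_le//; apply: le_trans pq _.
by rewrite -quantile_in_le.
Qed.

(** Were a neighbourhood of radius [e] around the quantile [Q] null, [cumul mu] would already reach
    [p] at [Q - e]. *)
Lemma quantile_in_supp p : 0 < p < 1 -> supp mu (quantile_in mu p).
Proof.
move=> p01 e e0; rewrite lt0e measure_ge0 andbT; apply/eqP => mu0.
set Q := quantile_in mu p in mu0.
have : Q <= Q - e; last by rewrite leNgt; lra.
rewrite quantile_in_le//; have : p <= cumul mu Q by rewrite -quantile_in_le.
move=> /le_trans; apply; rewrite -lee_fin !cumulE.
have := @cumul_le_add (Q - e) Q (Q + e); rewrite mu0 adde0; apply.
by rewrite ltrDl.
Qed.

End cumulative.

(** * From complex to real test functions *)

Lemma cvg_in_distribution_real (R : realType)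
    (mu : nat -> probability (measurableTypeR R) R)
    (Lam : probability (measurableTypeR R) R) (f : R -> R) :
  cvg_in_distribution mu Lam -> continuous f -> bounded_fun f ->
  \int[mu n]_x f x @[n --> \oo] --> \int[Lam]_x f x.
Proof.
move=> cvg_mu cf [M [_ fM]].
pose g : R -> R[i]^o := fun x => ((f x)%:C)%C.
have cg : continuous g.
  move=> x; apply/cvgrPdist_lt => /= e e0.
  (* The radius [e] is an element of [R[i]]; being positive, it is real and equals its real part. *)
  have eE := RRe_real (gtr0_real e0).
  have e0' : 0 < complex.Re e by rewrite -ltcR eE.
  have /cvgrPdist_lt/(_ _ e0') := cf x; apply: filterS => y /= fxy.
  by rewrite -rmorphB normc_def/= expr0n/= addr0 sqrtr_sqr -eE ltcR.
have bg : bounded_fun g.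
  exists ((M%:C)%C); split; first by apply/complex_realP; exists M.
  move=> N MN x _ /=.
  have NE : ((complex.Re N)%:C)%C = N.
    apply: RRe_real; rewrite (ger_real (ltW MN)).
    by apply/complex_realP; exists M.
  rewrite normc_def/= expr0n/= addr0 sqrtr_sqr -NE lecR.
  by apply: fM => //; rewrite -ltcR NE.
have := cvg_mu g cg bg => /cvgrPdist_lt/= cvg_g.
apply/cvgrPdist_lt => e e0.
have e0' : 0 < ((e%:C)%C) :> R[i] by rewrite ltcR.
(* The modulus dominates the real part, which here is the difference of the real integrals. *)
apply: filterS (cvg_g _ e0') => n /=; rewrite -ltcR; apply: le_lt_trans.
exact: (normc_ge_Re (cintegral Lam g - cintegral (mu n) g)).
Qed.

(** * Piecewise linear test functions *)

Section ramp.
Context {R : realType}.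

(** For [s < t] this is 1 up to [s], 0 from [t] on and affine in between, so it lies between the
    indicators of the rays ending at [s] and at [t]. *)
Definition ramp (s t x : R) : R := Num.max 0 (Num.min 1 ((t - x) / (t - s))).

Lemma ramp_continuous s t : continuous (ramp s t).
Proof.
move=> x; apply: (@continuous_max _ _ (fun=> 0) _ x); first exact: cvg_cst.
apply: (@continuous_min _ _ (fun=> 1) _ x); first exact: cvg_cst.
by apply: cvgM; [apply: cvgB; [exact: cvg_cst|exact: cvg_id]|exact: cvg_cst].
Qed.

Lemma ramp_ge0 s t x : 0 <= ramp s t x.
Proof. by rewrite le_max lexx. Qed.

Lemma ramp_le1 s t x : ramp s t x <= 1.
Proof. by rewrite ge_max ler01 ge_min lexx. Qed.

Lemma ramp_bounded s t : bounded_fun (ramp s t).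
Proof.
exists 1; split=> // M M1 x _ /=.
by rewrite ger0_norm ?ramp_ge0// (le_trans (ramp_le1 _ _ _))// ltW.
Qed.

Lemma integrable_ramp (mu : probability (measurableTypeR R) R) s t :
  mu.-integrable setT (EFin \o ramp s t).
Proof.
apply: measurable_bounded_integrable => //.
- by rewrite -ge0_fin_numE// fin_num_measure.
- apply: measurable_realfun.continuous_measurable_fun; exact: ramp_continuous.
- exact: ramp_bounded.
Qed.

Lemma Rintegral_indic_cumul (mu : probability (measurableTypeR R) R) v :
  \int[mu]_x (\1_(`]-oo, v]) x : R) = cumul mu v.
Proof. by rewrite /Rintegral integral_indic// setIT. Qed.

Lemma integrable_indic_ray (mu : probability (measurableTypeR R) R) v :
  mu.-integrable setT (EFin \o (\1_(`]-oo, v]) : R -> R)).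
Proof. exact: integrable_indic. Qed.

Lemma cumul_le_ramp (mu : probability (measurableTypeR R) R) s t :
  s < t -> cumul mu s <= \int[mu]_x ramp s t x.
Proof.
move=> st; rewrite -Rintegral_indic_cumul; apply: le_Rintegral => //.
- exact: integrable_indic_ray.
- exact: integrable_ramp.
move=> x _; rewrite indicE; case: (boolP (x \in _)) => /=; last by rewrite ramp_ge0.
rewrite inE/= in_itv/= => xs.
by rewrite le_max le_min lexx/= ler_pdivlMr ?subr_gt0// mul1r lerB// orbT.
Qed.

Lemma ramp_le_cumul (mu : probability (measurableTypeR R) R) s t :
  s < t -> \int[mu]_x ramp s t x <= cumul mu t.
Proof.
move=> st; rewrite -Rintegral_indic_cumul; apply: le_Rintegral => //.
- exact: integrable_ramp.
- exact: integrable_indic_ray.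
move=> x _; rewrite indicE; case: (boolP (x \in _)) => /=; first by rewrite ramp_le1.
rewrite notin_setE/= in_itv/= => /negP; rewrite -ltNge => tx.
rewrite ge_max lexx ge_min; apply/orP; right.
by rewrite pmulr_lle0 ?invr_gt0 ?subr_gt0// subr_le0 ltW.
Qed.

End ramp.

(** * Distribution functions under convergence in distribution *)

Lemma cvg_Rintegral_ramp {R : realType} (Lam : probability (measurableTypeR R) R)
    (mu : nat -> probability (measurableTypeR R) R) s t :
  cvg_in_distribution mu Lam ->
  \int[mu n]_x ramp s t x @[n --> \oo] --> \int[Lam]_x ramp s t x.
Proof.
by move=> mu_cvg; apply: cvg_in_distribution_real => //;
  [exact: ramp_continuous|exact: ramp_bounded].
Qed.

Lemma near_cumul_le {R : realType} (Lam : probability (measurableTypeR R) R)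
    (mu : nat -> probability (measurableTypeR R) R) s v u :
  cvg_in_distribution mu Lam -> s < v < u -> supp Lam v ->
  \forall n \near \oo,
    cumul Lam s <= cumul (mu n) u /\ cumul (mu n) s <= cumul Lam u.
Proof.
move=> mu_cvg /andP[sv vu] Sv.
(* Half of the smaller gap leaves room for one ramp on each side of the neighbourhood of [v]: from
   [s] to [v - e] and from [v + e] to [u]. *)
pose e := Num.min ((v - s) / 2) ((u - v) / 2).
have e0 : 0 < e by rewrite lt_min; apply/andP; split; lra.
have es : s < v - e.
  have : e <= (v - s) / 2 by rewrite ge_min lexx.
  by lra.
have eu : v + e < u.
  have : e <= (u - v) / 2 by rewrite ge_min lexx orbT.
  by lra.
(* The mass near [v] gives a strict inequality, which survives the passage from [Lam] to [mu n] for
   large [n]. *)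
have Fve : cumul Lam (v - e) < cumul Lam (v + e).
  have vee : v - e <= v + e by lra.
  rewrite -lte_fin; have := cumul_add_le Lam vee; rewrite -!cumulE.
  by apply: lt_le_trans; rewrite lteDl//; exact: Sv.
have Fs : cumul Lam s < \int[Lam]_x ramp (v + e) u x.
  apply: lt_le_trans (cumul_le_ramp _ eu); apply: le_lt_trans Fve.
  exact/cumul_nondecreasing/ltW.
have Fu : \int[Lam]_x ramp s (v - e) x < cumul Lam u.
  apply: le_lt_trans (ramp_le_cumul _ es) _; apply: lt_le_trans Fve _.
  exact/cumul_nondecreasing/ltW.
near=> n; split.
- apply: le_trans (ramp_le_cumul _ eu); apply: ltW; near: n.
  exact: cvgr_gt (cvg_Rintegral_ramp mu_cvg) _ Fs.
- apply: le_trans (cumul_le_ramp _ es) _; apply: ltW; near: n.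
  exact: cvgr_lt (cvg_Rintegral_ramp mu_cvg) _ Fu.
Unshelve. all: by end_near. Qed.

(** * Uniform estimate for orders strictly between 0 and 1 *)

Lemma near_quantile_in_dist_le {R : realType} (Lam : probability (measurableTypeR R) R)
    (mu : nat -> probability (measurableTypeR R) R) (e : R) :
  cvg_in_distribution mu Lam -> bounded_set (supp Lam) -> connected (supp Lam) ->
  (forall n, supp (mu n) `<=` supp Lam) -> 0 < e ->
  \forall n \near \oo, forall p, 0 < p < 1 ->
    `|quantile_in (mu n) p - quantile_in Lam p| <= e.
Proof.
move=> mu_cvg [M0 [_ /(_ (M0 + 1))]] /=; rewrite ltrDl ltr01 => /(_ erefl).
set M := M0 + 1 => SM /connected_intervalP Sitv SS e0.
pose h := e / 2; have h0 : 0 < h by rewrite /h; lra.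
pose t (i : nat) : R := - M + i%:R * h.
have tS i : t i.+1 = t i + h by rewrite /t -natr1 mulrDl mul1r addrA.
(* A point of [[-M, M]] lies in a cell of index at most [truncn ((M + M) / h)]. The cell after it is
   the one used, so its index must also be below [K]. *)
pose K := (Num.truncn ((M + M) / h)).+2.
(* Finitely many cells allow one threshold on [n] for all of them, independent of [p]. Cells whose
   interior misses the support carry no claim. *)
have near_grid : \forall n \near \oo, forall i : 'I_K,
    (exists2 v, t i < v < t i.+1 & supp Lam v) ->
    cumul Lam (t i) <= cumul (mu n) (t i.+1) /\
    cumul (mu n) (t i) <= cumul Lam (t i.+1).
  apply: filter_forall => i.
  have [[v tv Sv]|noS] := pselect (exists2 v, t i < v < t i.+1 & supp Lam v).
    by apply: filterS (near_cumul_le mu_cvg tv Sv).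
  by apply: nearW => n /noS.
have grid_between x y : supp Lam x -> supp Lam y -> x + e < y ->
    exists i : 'I_K, [/\ x <= t i, t i.+1 < y &
      exists2 v, t i < v < t i.+1 & supp Lam v].
  move=> Sx Sy xey.
  have := SM x Sx; rewrite ler_norml => /andP[Mx xM].
  have xMh0 : 0 <= (x + M) / h by rewrite divr_ge0 ?(ltW h0)//; lra.
  (* With [x] in cell [k], cell [k.+1] starts after [x] and ends at most at [x + 2 * h], that is
     [x + e], hence before [y]. *)
  pose k := Num.truncn ((x + M) / h).
  have kK : (k.+1 < K)%N.
    by rewrite !ltnS; apply: le_truncn; rewrite ler_pM2r ?invr_gt0// lerD2r.
  have /andP[] := truncn_itv xMh0; rewrite -/k ler_pdivlMr// ltr_pdivrMr// => kx xk.
  have xt : x < t k.+1 by rewrite /t; lra.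
  have ty : t k.+2 < y.
    have tkx : t k <= x by rewrite /t; lra.
    by rewrite !tS /h; rewrite /h in tkx *; lra.
  exists (Ordinal kK); split => //=; first exact: ltW.
  (* The midpoint of the cell lies between [x] and [y], so it is in the support, which is an
     interval. *)
  exists (t k.+1 + h / 2); first by rewrite (tS k.+1); apply/andP; split; lra.
  apply: (Sitv x y) => //; apply/andP; split; first lra.
  by apply: ltW; apply: lt_trans ty; rewrite (tS k.+1); lra.
apply: filterS near_grid => n gridn p p01.
have SQ := quantile_in_supp Lam p01; have SQn := SS n _ (quantile_in_supp (mu n) p01).
rewrite ler_distl; apply/andP; split; rewrite leNgt; apply/negP => Qlt.
(* If the quantile of [mu n] is at most [t i], then [p <= cumul (mu n) (t i) <= cumul Lam (t i.+1)],
   so that of [Lam] is at most [t i.+1], a contradiction. The other case is symmetric. *)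
- have [|i [Qt tQ /gridn[_ le_cumul]]] := grid_between _ _ SQn SQ; first lra.
  move: tQ; rewrite ltNge quantile_in_le// (le_trans _ le_cumul)//.
  by rewrite -quantile_in_le.
- have [|i [Qt tQ /gridn[le_cumul _]]] := grid_between _ _ SQ SQn; first lra.
  move: tQ; rewrite ltNge quantile_in_le// (le_trans _ le_cumul)//.
  by rewrite -quantile_in_le.
Qed.

(** * Passage to the orders 0 and 1 *)

Section endpoints.
Context {R : realType}.
Implicit Types mu nu : probability (measurableTypeR R) R.

(** Quantiles are monotone in the order and, lying in the support, bounded. *)
Lemma is_cvg_quantile_in_0 mu : bounded_set (supp mu) ->
  cvg (quantile_in mu q @[q --> 0^'+]).
Proof.
move=> [M0 [_ /(_ (M0 + 1))]] /=; rewrite ltrDl ltr01 => /(_ erefl) SM.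
have near1 : \forall x \near (0 : R)^'+, x < 1 by exact: nbhs_right_lt.
apply: nondecreasing_at_right_is_cvgr; apply: filterS near1 => x x1.
  move=> p q; rewrite !in_itv/= => /andP[p0 px] /andP[q0 qx].
  by apply: quantile_in_nondecreasing; apply/andP; split => //; exact: lt_trans x1.
exists (- (M0 + 1)) => y [p /=]; rewrite in_itv/= => /andP[p0 px] <-.
have /SM : supp mu (quantile_in mu p).
  by apply: quantile_in_supp; rewrite p0 (lt_trans px).
by rewrite ler_norml => /andP[].
Qed.

Lemma is_cvg_quantile_in_1 mu : bounded_set (supp mu) ->
  cvg (quantile_in mu q @[q --> 1^'-]).
Proof.
move=> [M0 [_ /(_ (M0 + 1))]] /=; rewrite ltrDl ltr01 => /(_ erefl) SM.
have near0 : \forall x \near (1 : R)^'-, 0 < x by exact: nbhs_left_gt.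
apply: nondecreasing_at_left_is_cvgr; apply: filterS near0 => x x0.
  move=> p q; rewrite !in_itv/= => /andP[xp p1] /andP[xq q1].
  by apply: quantile_in_nondecreasing; apply/andP; split => //; exact: lt_trans x0 _.
exists (M0 + 1) => y [p /=]; rewrite in_itv/= => /andP[xp p1] <-.
have /SM : supp mu (quantile_in mu p).
  by apply: quantile_in_supp; rewrite p1 (lt_trans x0).
by rewrite ler_norml => /andP[].
Qed.

Lemma lim_dist_le (F : set_system R) (f g : R -> R) (e : R) : ProperFilter F ->
  cvg (f q @[q --> F]) -> cvg (g q @[q --> F]) ->
  (\forall q \near F, `|f q - g q| <= e) ->
  `|lim (f q @[q --> F]) - lim (g q @[q --> F])| <= e.
Proof.
move=> FF cf cg fg; rewrite -limB// ler_norml; apply/andP; split.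
- apply: limr_ge; first exact: is_cvgB.
  by apply: filterS fg => q; rewrite ler_norml => /andP[].
- apply: limr_le; first exact: is_cvgB.
  by apply: filterS fg => q; rewrite ler_norml => /andP[].
Qed.

Lemma quantile_dist_le mu nu (e : R) :
  bounded_set (supp mu) -> bounded_set (supp nu) ->
  (forall p, 0 < p < 1 -> `|quantile_in mu p - quantile_in nu p| <= e) ->
  forall p, 0 <= p <= 1 -> `|quantile mu p - quantile nu p| <= e.
Proof.
move=> Smu Snu dist_le p /andP[p0 p1]; rewrite /quantile.
have [_|pN0] := eqVneq p 0.
  apply: lim_dist_le; [exact: is_cvg_quantile_in_0..|].
  near=> q; apply: dist_le; apply/andP; split; near: q.
    exact: nbhs_right_gt.
  exact: nbhs_right_lt.
have [_|pN1] := eqVneq p 1.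
  apply: lim_dist_le; [exact: is_cvg_quantile_in_1..|].
  near=> q; apply: dist_le; apply/andP; split; near: q.
    exact: nbhs_left_gt.
  exact: nbhs_left_lt.
by apply: dist_le; rewrite !lt_neqAle pN1 p0 p1 eq_sym pN0.
Unshelve. all: by end_near. Qed.

End endpoints.

(** * Convergence of the supremum *)

Theorem theorem1p1 (R : realType) (Lam : probability (measurableTypeR R) R)
    (mu : nat -> probability (measurableTypeR R) R)
    (mu_cvg : cvg_in_distribution mu Lam)
    (supp_bounded : bounded_set (supp Lam))
    (supp_connected : connected (supp Lam))
    (supp_sub : forall n, supp (mu n) `<=` supp Lam) :
  ereal_sup [set (`|quantile (mu n) p - quantile Lam p|)%:E | p in `[0, 1]]
    @[n --> \oo] --> 0%E.
Proof.
set d := fun n => ereal_sup _.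
have near_d (e : R) : 0 < e -> \forall n \near \oo, (0 <= d n <= e%:E)%E.
  move=> e0.
  apply: filterS (near_quantile_in_dist_le mu_cvg supp_bounded supp_connected
    supp_sub e0).
  move=> n dist_le; apply/andP; split.
    (* The term at [p = 0] is nonnegative and bounds the supremum from below. *)
    apply: le_trans (ereal_sup_ubound _); last first.
      by exists 0 => //=; rewrite in_itv/= lexx ler01.
    by rewrite lee_fin.
  apply: ge_ereal_sup => y [p /=]; rewrite in_itv/= => p01 <-; rewrite lee_fin.
  apply: quantile_dist_le p01 => //.
  by apply: sub_boundedr supp_bounded => P; apply: subset_trans; exact: supp_sub.
have d_fin n x : (0 <= d n <= x%:E)%E -> d n \is a fin_num.
  by move=> /andP[d0 dx]; rewrite ge0_fin_numE// (le_lt_trans dx)// ltry.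
(* Convergence in the extended reals to a finite limit amounts to eventual finiteness, here from the
   bound 1, and convergence of the real values. *)
apply/fine_cvgP; split; first by apply: filterS (near_d 1 ltr01) => n /d_fin.
apply/cvgr0Pnorm_le => e e0; apply: filterS (near_d e e0) => n dn.
have /andP[d0 de] := dn.
by rewrite ger0_norm ?fine_ge0// -lee_fin fineK//; exact: d_fin dn.
Qed.
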